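(* Let $A\in\mathbb{R}^{m\times n}$, $\sigma>0$, $\epsilon\in(0,1)$, an uncertainty set $\mathcal{U}\subset\mathbb{R}^m$, a positive integer $s\le n$, and reals $\bar\gamma\ge0$, $\upsilon\ge0$ be given. Let $H=[h_1,\dots,h_n]\in\mathbb{R}^{m\times n}$ be a matrix such that $|[I-H^TA]_{ij}|\le\bar\gamma$ for all $i,j$ and $\nu(H)=\omega_*(\bar\gamma)$. Assume that $s\bar\gamma<1$. Then there exists a set $\Xi\subset\mathbb{R}^m$ with $\mathrm{Prob}\{\xi\in\Xi\}\ge1-\epsilon$ (where $\xi\sim N(0,I_m)$) such that whenever $\xi\in\Xi$, for every $x\in\mathbb{R}^n$ satisfying $\|x-x^s\|_1\le\upsilon$ and every $u\in\mathcal{U}$, the approximate solutions $v^{(k)}$ and the values $\alpha_k$, $k=0,1,2,\dots$, produced by the Non-Euclidean Matching Pursuit algorithm applied to $y=Ax+u+\sigma\xi$ satisfy: $(a_k)$ $v^{(k)}_i\in\mathrm{Conv}\{0;x_i\}$ for all $i$; $(b_k)$ $\|x-v^{(k)}\|_1\le\alpha_k$ and $\|x-v^{(k+1)}\|_\infty\le2\bar\gamma\alpha_k+2\omega_*(\bar\gamma)$.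
   Context: $\mathcal{U}\subset\mathbb{R}^m$ is a (nonempty) convex compact set symmetric with respect to the origin. $x^s$ is obtained from $x$ by zeroing all but the $s$ largest in magnitude entries (ties resolved in favour of smaller indices); $\|x\|_{s,1}=\|x^s\|_1$. $\nu(v)=\sup_{u\in\mathcal{U}}u^Tv+\sigma\sqrt{2\ln(n/\epsilon)}\|v\|_2$ for $v\in\mathbb{R}^m$, $\nu(H)=\max_i\nu(h_i)$. $\omega_*(\gamma)=\max_{1\le i\le n}\min_{h\in\mathbb{R}^m}\{\nu(h):\|A^Th-e_i\|_\infty\le\gamma\}$, with $e_i$ the $i$-th standard basis vector of $\mathbb{R}^n$. Non-Euclidean Matching Pursuit algorithm (with data $A,H,\bar\gamma,s,\upsilon$ and observation $y$): Initialization: $v^{(0)}=0$, $\alpha_0=\dfrac{\|H^Ty\|_{s,1}+s\nu(H)+\upsilon}{1-s\bar\gamma}$. Step $k=1,2,\dots$: given $v^{(k-1)}\in\mathbb{R}^n$ and $\alpha_{k-1}\ge0$, compute $w=H^T(y-Av^{(k-1)})$ and $\Delta\in\mathbb{R}^n$ with entries $\Delta_i=\mathrm{sign}(w_i)\,[|w_i|-\bar\gamma\alpha_{k-1}-\nu(H)]_+$, $1\le i\le n$, where $[a]_+=\max[0,a]$; set $v^{(k)}=v^{(k-1)}+\Delta$ and $\alpha_k=2s\bar\gamma\alpha_{k-1}+2s\nu(H)+\upsilon$. *)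

(* Defs.v *)
From HB Require Import structures.
From mathcomp Require Import all_boot all_order all_algebra.
From mathcomp Require Import all_classical all_reals all_analysis.

Set Implicit Arguments.
Unset Strict Implicit.
Unset Printing Implicit Defensive.
Import Order.TTheory GRing.Theory Num.Theory.
Import numFieldNormedType.Exports.

Local Open Scope classical_set_scope.
Local Open Scope ring_scope.
Local Open Scope convex_scope.

(* Vectors are columns ['cV[R]_n]; their sup-norm is the library norm [`|x|]
   on matrices. *)

Definition norm1 (R : realType) (n : nat) (x : 'cV[R]_n) : R :=
  \sum_(i < n) `|x i 0|.

Definition norm2 (R : realType) (n : nat) (x : 'cV[R]_n) : R :=
  Num.sqrt (\sum_(i < n) x i 0 ^+ 2).

(* Entry [j] comes before entry [i] in the ordering by decreasing magnitude,
   ties being resolved in favour of smaller indices; [i] is then one of the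
   [s] largest entries iff fewer than [s] entries come before it. *)
Definition before (R : realType) (n : nat) (x : 'cV[R]_n) (j i : 'I_n) : bool :=
  (`|x i 0| < `|x j 0|) || ((`|x i 0| == `|x j 0|) && (j < i)%N).

Definition keep_largest (R : realType) (n s : nat) (x : 'cV[R]_n) : 'cV[R]_n :=
  \col_i (if (#|[set j | before x j i]%SET| < s)%N then x i 0 else 0).

Definition norms1 (R : realType) (n s : nat) (x : 'cV[R]_n) : R :=
  norm1 (keep_largest s x).

Definition symmetric_set (R : realType) (m : nat) (U : set 'cV[R]_m) : Prop :=
  forall u, U u -> U (- u).

(* For [U] nonempty and compact the set under [sup] is nonempty and bounded. *)
Definition nu (R : realType) (m n : nat) (U : set 'cV[R]_m) (sigma eps : R)
    (v : 'cV[R]_m) : R :=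
  sup [set (u^T *m v) 0 0 | u in U]
    + sigma * Num.sqrt (2 * ln (n%:R / eps)) * norm2 v.

(* [nu] is nonnegative when [U] is nonempty, compact and symmetric, so for
   [0 < n] the base value 0 does not affect the maximum; likewise for
   [omega_star]. *)
Definition nu_mx (R : realType) (m n : nat) (U : set 'cV[R]_m) (sigma eps : R)
    (H : 'M[R]_(m, n)) : R :=
  \big[Num.max/0]_(i < n) nu n U sigma eps (col i H).

(* When the constraint set is nonempty, the infimum is attained (i.e. it is a
   minimum): the set is closed and [nu], for [0 < sigma] and [eps < n], is
   continuous and coercive. *)
Definition omega_star (R : realType) (m n : nat) (U : set 'cV[R]_m)
    (sigma eps : R) (A : 'M[R]_(m, n)) (gamma : R) : R :=
  \big[Num.max/0]_(i < n)
    inf [set nu n U sigma eps h |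
         h in [set h : 'cV[R]_m | `|A^T *m h - delta_mx i 0| <= gamma]].

Definition nemp_step (R : realType) (m n : nat) (A H : 'M[R]_(m, n))
    (gbar nuH : R) (y : 'cV[R]_m) (v : 'cV[R]_n) (alpha : R) : 'cV[R]_n :=
  let w := H^T *m (y - A *m v) in
  v + \col_i (Num.sg (w i 0) * Num.max 0 (`|w i 0| - gbar * alpha - nuH)).

(* The pair (v^(k), alpha_k). *)
Fixpoint nemp (R : realType) (m n : nat) (A H : 'M[R]_(m, n))
    (gbar nuH : R) (s : nat) (upsilon : R) (y : 'cV[R]_m) (k : nat)
    : 'cV[R]_n * R :=
  match k with
  | 0%N => (0, (norms1 s (H^T *m y) + s%:R * nuH + upsilon) / (1 - s%:R * gbar))
  | k'.+1 =>
      let: (v, alpha) := nemp A H gbar nuH s upsilon y k' in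
      (nemp_step A H gbar nuH y v alpha,
       2 * s%:R * gbar * alpha + 2 * s%:R * nuH + upsilon)
  end.

Definition Conv2 (R : realType) (a b : R) : set R :=
  range (fun t : {i01 R} => (a : R^o) <| t |> (b : R^o)).

(* xi ~ N(0, I_m): the coordinates of [xi] are independent standard normal
   random variables. The product rule over all of ['I_m] contains the one over
   every subfamily: take [B i = setT] for the other indices. *)
Definition standard_normal_vector (R : realType) (m : nat)
    (d : measure_display) (T : measurableType d) (P : probability T R)
    (xi : T -> 'cV[R]_m) : Prop :=
  [/\ forall i : 'I_m, measurable_fun setT (fun t => xi t i 0),
      forall (i : 'I_m) (B : set R), measurable B ->
        P [set t | B (xi t i 0)] = normal_prob 0 1 B
    & forall B : 'I_m -> set R, (forall i, measurable (B i)) ->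
        P [set t | forall i, B i (xi t i 0)]
          = (\prod_(i < m) P [set t | B i (xi t i 0%R)])%E].

(* Main.v *)
Require Import Defs.
From HB Require Import structures.
From mathcomp Require Import all_boot all_order all_algebra.
From mathcomp Require Import all_classical all_reals all_analysis.
From mathcomp Require Import measurable_realfun ring lra.

Set Implicit Arguments.
Unset Strict Implicit.
Unset Printing Implicit Defensive.
Import Order.TTheory GRing.Theory Num.Theory.
Import numFieldNormedType.Exports.

Local Open Scope classical_set_scope.
Local Open Scope ring_scope.

(** The noise enters the algorithm only through [H^T (u + sigma xi)], so [Xi] is
    taken to be the set of all [xi] with [|h_i^T xi| <= tau |h_i|_2] for every
    column [h_i] of [H], where [tau = sqrt (2 ln (n / eps))]. On this event, and
    for [u] in the symmetric set [U], every entry of the noise is at most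
    [nu(h_i) <= nu(H)] ([noise_bound]). What remains splits in two.

    The deterministic half. If [v] is the current iterate, [d = x - v], and
    [|d|_1 <= alpha], then [w = H^T (y - A v)] differs from [d] by
    [(I - H^T A) d] plus noise, hence by at most [gbar alpha + nu(H)] in every
    entry ([residual_error]). Soft-thresholding [w] at exactly this level gives a
    correction that lies between [0] and [d] and misses [d] by at most twice the
    level, entry by entry. So the iterate never leaves the segments from [0] to
    [x_i], and the new error is at most [2 (gbar alpha + nu(H))] on the [s]
    largest entries of [x] and at most [|x_i|], of total at most [upsilon], on
    the others: this is the recursion of [alpha]. The initial bound comes from
    solving [|x|_1 <= |H^T y|_{s,1} + s (gbar |x|_1 + nu(H)) + upsilon] for
    [|x|_1] ([norm1_le_alpha0]).

    The probabilistic half. A linear form [h^T xi] of a standard normal vector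
    is distributed as [|h|_2] times a standard normal variable
    ([gaussian_sum_law]), and the two-sided tail of the latter beyond [tau] is at
    most [exp (- tau^2 / 2) = eps / n] ([normal_prob_tail]); the constant [1] in
    front is what makes the union bound over the [n] columns give [eps]. The law
    of [h^T xi] is found by adding one coordinate at a time, which reduces it to
    the rotation invariance of the standard normal law of the plane
    ([normal_prob_rotate]): a linear change of variables in one coordinate,
    Tonelli, and a linear change of variables in the other. *)

(** * The entries of largest magnitude *)

Lemma before_irr (R : realType) (n : nat) (x : 'cV[R]_n) (i : 'I_n) :
  before x i i = false.
Proof. by rewrite /before ltxx ltnn andbF. Qed.

Lemma before_trans (R : realType) (n : nat) (x : 'cV[R]_n) (i j k : 'I_n) :
  before x i j -> before x j k -> before x i k.
Proof.
rewrite /before => /orP[ij|/andP[/eqP <- ij]] /orP[jk|/andP[/eqP jk jk']].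
- by rewrite (lt_trans jk ij).
- by rewrite jk ij.
- by rewrite jk.
- by rewrite jk eqxx (ltn_trans ij jk') orbT.
Qed.

Lemma before_total (R : realType) (n : nat) (x : 'cV[R]_n) (i j : 'I_n) :
  i != j -> before x i j || before x j i.
Proof.
move=> ij; rewrite /before; case: (ltgtP `|x i 0| `|x j 0|) => //= _.
by case: (ltngtP i j) ij => // /val_inj ->; rewrite eqxx.
Qed.

(** The position in the order by decreasing magnitude. [before] being a strict
    total order, this numbers the entries bijectively, which is how
    [keep_largest] is seen to keep exactly [s] of them. *)
Definition mag_rank (R : realType) (n : nat) (x : 'cV[R]_n) (i : 'I_n) : nat :=
  #|[set j | before x j i]%SET|.

Lemma mag_rank_lt (R : realType) (n : nat) (x : 'cV[R]_n) (i j : 'I_n) :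
  before x i j -> (mag_rank x i < mag_rank x j)%N.
Proof.
move=> ij; apply/proper_card/properP; split.
  by apply/fintype.subsetP => k; rewrite !inE => /before_trans; apply.
by exists i; rewrite !inE // before_irr.
Qed.

Lemma mag_rank_inj (R : realType) (n : nat) (x : 'cV[R]_n) :
  injective (mag_rank x).
Proof.
move=> i j ij; apply/eqP/negP => /negP /(before_total x) /orP[] /mag_rank_lt;
by rewrite ij ltnn.
Qed.

Lemma mag_rank_bound (R : realType) (n : nat) (x : 'cV[R]_n) (i : 'I_n) :
  (mag_rank x i < n)%N.
Proof.
rewrite -[X in (_ < X)%N](card_ord n) -cardsT; apply/proper_card/properP.
by split; [exact/fintype.subsetP | exists i; rewrite !inE // before_irr].
Qed.

Definition top_set (R : realType) (n s : nat) (x : 'cV[R]_n) : {set 'I_n} :=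
  [set i | (mag_rank x i < s)%N]%SET.

Lemma card_top_set (R : realType) (n s : nat) (x : 'cV[R]_n) :
  (s <= n)%N -> #|top_set s x| = s.
Proof.
move=> sn; pose r i := Ordinal (mag_rank_bound x i).
have r_inj : injective r by move=> i j [] /mag_rank_inj.
have -> : top_set s x = (r @^-1: [set k : 'I_n | (k < s)%N])%SET.
  by apply/setP => i; rewrite !inE.
rewrite on_card_preimset; last exact/onW_bij/injF_bij.
have -> : [set k : 'I_n | (k < s)%N]%SET = (widen_ord sn @: [set: 'I_s])%SET.
  apply/setP => k; rewrite !inE; apply/idP/imsetP => [ks|[l _ ->]//=].
  by exists (Ordinal ks) => //; apply: val_inj.
rewrite card_imset ?cardsT ?card_ord //.
by move=> k l /(congr1 val) /= /val_inj.
Qed.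

(** The least value of [f] on [B] bounds every value on [A]; the terms that [B]
    has in excess are nonnegative. *)
Lemma ler_sum_card (R : realDomainType) (I : finType) (A B : {set I})
    (f : I -> R) :
  (#|A| <= #|B|)%N -> (forall i, 0 <= f i) ->
  (forall i j, i \in A -> j \in B -> f i <= f j) ->
  \sum_(i in A) f i <= \sum_(j in B) f j.
Proof.
move=> AB f_ge0 fAB; have [B0|[b0 b0B]] := set_0Vmem B.
  move: AB; rewrite B0 cards0 leqn0 cards_eq0 => /eqP ->.
  by rewrite !big_set0.
have [b bB b_min] := arg_minP f b0B.
apply: (@le_trans _ _ (f b *+ #|A|)).
  by rewrite -sumr_const; apply: ler_sum => i iA; exact: fAB.
apply: (@le_trans _ _ (f b *+ #|B|)); first exact: ler_wpMn2l.
by rewrite -sumr_const; apply: ler_sum => j; exact: b_min.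
Qed.

Lemma norms1E (R : realType) (n s : nat) (x : 'cV[R]_n) :
  norms1 s x = \sum_(i in top_set s x) `|x i 0|.
Proof.
rewrite /norms1 /norm1 [RHS]big_mkcond; apply: eq_bigr => i _.
by rewrite mxE inE -/(mag_rank x i); case: ifP; rewrite ?normr0.
Qed.

Lemma norm1_ge0 (R : realType) (n : nat) (z : 'cV[R]_n) : 0 <= norm1 z.
Proof. exact: sumr_ge0. Qed.

Lemma norm1_setID (R : realType) (n : nat) (J : {set 'I_n}) (z : 'cV[R]_n) :
  norm1 z = \sum_(i in J) `|z i 0| + \sum_(i in ~: J) `|z i 0|.
Proof.
rewrite /norm1 (bigID (mem J)) /=; congr (_ + _).
by apply: eq_bigl => i; rewrite inE.
Qed.

Lemma norm1_tailE (R : realType) (n s : nat) (x : 'cV[R]_n) :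
  norm1 (x - keep_largest s x) = \sum_(i in ~: top_set s x) `|x i 0|.
Proof.
rewrite /norm1 [RHS]big_mkcond; apply: eq_bigr => i _.
by rewrite !mxE !inE -/(mag_rank x i); case: ifP; rewrite ?subrr ?normr0 ?subr0.
Qed.

(** Among the sets of at most [s] entries, the top one has the largest sum: the
    entries that [I] has outside of it are no more numerous, and no larger, than
    those that it has outside of [I]. *)
Lemma sum_le_norms1 (R : realType) (n s : nat) (x : 'cV[R]_n)
    (I : {set 'I_n}) :
  (s <= n)%N -> (#|I| <= s)%N -> \sum_(i in I) `|x i 0| <= norms1 s x.
Proof.
move=> sn Is; rewrite norms1E; set J := top_set s x.
rewrite (big_setID J) [leRHS](big_setID I) /= finset.setIC lerD2l.
apply: ler_sum_card => //.
  rewrite -(leq_add2l #|I :&: J|) cardsID finset.setIC cardsID.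
  by rewrite card_top_set.
move=> i j; rewrite !inE -leqNgt => /andP[iJ _] /andP[_ jJ].
rewrite leNgt; apply/negP => ji.
have /mag_rank_lt : before x i j by rewrite /before ji.
by rewrite ltnNge ltnW // (leq_trans jJ iJ).
Qed.

(** * Soft thresholding and the pursuit iteration *)

Lemma Conv2_0P (R : realType) (x v : R) :
  Conv2 0 x v <-> (0 <= v <= x) \/ (x <= v <= 0).
Proof.
split=> [[t _ <-]|vx].
  have t0 : 0 <= 1 - t%:inum by rewrite subr_ge0.
  have t1 : 1 - t%:inum <= 1 by rewrite gerBl.
  rewrite convRE mulr0 add0r; case: (leP 0 x) => x0; [left|right].
    by rewrite mulr_ge0 // ler_piMl.
  by rewrite ler_niMl ?(ltW x0) // mulr_ge0_le0 // ltW.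
have [x0|x0] := eqVneq x 0.
  by exists 0%:i01 => //; rewrite conv0; lra.
have /andP[q0 q1] : 0 <= v / x <= 1.
  case: vx => /andP[v1 v2].
    have xp : 0 < x by rewrite lt_neqAle eq_sym x0 (le_trans v1).
    by rewrite divr_ge0 ?(ltW xp) // ler_pdivrMr // mul1r.
  have xn : x < 0 by rewrite lt_neqAle x0 (le_trans v1).
  by rewrite mulr_le0 ?invr_le0 ?(ltW xn) // ler_ndivrMr // mul1r.
have t0 : 0 <= 1 - v / x by rewrite subr_ge0.
have t1 : 1 - v / x <= 1 by rewrite gerBl.
(* The parameter of a convex combination weighs its first point, here 0. *)
exists (Itv01 t0 t1) => //.
by rewrite convRE /= mulr0 add0r /unstable.onem subKr divfK.
Qed.

(** Shrinking by a bound on the error of [w] makes the estimate of [d] never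
    overshoot [d] nor have the wrong sign. *)
Lemma soft_threshold_between (R : realDomainType) (d w tau : R) :
  `|w - d| <= tau ->
  let delta := Num.sg w * Num.max 0 (`|w| - tau) in
  (0 <= delta <= d) \/ (d <= delta <= 0).
Proof.
rewrite ler_norml => /andP[lo hi] /=; rewrite maxEle.
case: (ltgtP w 0) => [w0|w0|->].
- rewrite (ltr0_sg w0) (ltr0_norm w0); case: ifP => // c; lra.
- rewrite (gtr0_sg w0) (gtr0_norm w0); case: ifP => // c; lra.
- rewrite sgr0 mul0r; lra.
Qed.

Lemma soft_threshold_error (R : realDomainType) (d w tau : R) :
  `|w - d| <= tau ->
  `|d - Num.sg w * Num.max 0 (`|w| - tau)| <= 2 * tau.
Proof.
rewrite ler_norml => /andP[lo hi] /=; rewrite maxEle.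
case: (ltgtP w 0) => [w0|w0|w0].
- rewrite (ltr0_sg w0) (ltr0_norm w0); case: (leP 0 (- w - tau)) => c;
  rewrite ler_norml; lra.
- rewrite (gtr0_sg w0) (gtr0_norm w0); case: (leP 0 (w - tau)) => c;
  rewrite ler_norml; lra.
- rewrite w0 sgr0 mul0r ler_norml; lra.
Qed.

Section Pursuit.
Variables (R : realType) (m n : nat) (A H : 'M[R]_(m, n)).
Variables (gbar nuH : R) (s : nat) (upsilon : R).
Hypothesis s_le_n : (s <= n)%N.
Hypothesis gbar_ge0 : 0 <= gbar.
Hypothesis nuH_ge0 : 0 <= nuH.
Hypothesis H_gbar : forall i j : 'I_n, `|(1%:M - H^T *m A) i j| <= gbar.
Hypothesis s_gbar : s%:R * gbar < 1.
Variables (y : 'cV[R]_m) (x : 'cV[R]_n).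
Hypothesis noise : forall i, `|(H^T *m (y - A *m x)) i 0| <= nuH.
Hypothesis x_tail : norm1 (x - keep_largest s x) <= upsilon.

(** [H^T (y - A v) - (x - v)] is [H^T (y - A x) - (I - H^T A) (x - v)]: the
    noise, and the coherence bound times the l1 error. *)
Lemma residual_error (v : 'cV[R]_n) (i : 'I_n) :
  `|(H^T *m (y - A *m v)) i 0 - (x - v) i 0| <= gbar * norm1 (x - v) + nuH.
Proof.
have -> : (H^T *m (y - A *m v)) i 0 - (x - v) i 0 =
    (H^T *m (y - A *m x)) i 0 - ((1%:M - H^T *m A) *m (x - v)) i 0.
  rewrite mulmxBl mul1mx -mulmxA mulmxBr !mulmxBr.
  by rewrite !mxE; ring.
rewrite [leRHS]addrC (le_trans (ler_normB _ _)) // lerD // mxE.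
rewrite mulr_sumr (le_trans (ler_norm_sum _ _ _)) //; apply: ler_sum => j _.
by rewrite normrM ler_wpM2r.
Qed.

Let v k := (nemp A H gbar nuH s upsilon y k).1.
Let alpha k := (nemp A H gbar nuH s upsilon y k).2.

Lemma nemp_recE k :
  v k.+1 = nemp_step A H gbar nuH y (v k) (alpha k) /\
  alpha k.+1 = 2 * s%:R * gbar * alpha k + 2 * s%:R * nuH + upsilon.
Proof. by rewrite /v /alpha /=; case: nemp. Qed.

(** Bounding [|x_i|] by [|(H^T y)_i| + gbar |x|_1 + nuH] on the top set of [x]
    yields an inequality for [|x|_1] that can be solved because [s gbar < 1]. The
    top set of [x] need not be that of [H^T y], whence [sum_le_norms1]. *)
Lemma norm1_le_alpha0 : norm1 x <= alpha 0.
Proof.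
rewrite /alpha /= ler_pdivlMr ?subr_gt0 //.
have top_le : \sum_(i in top_set s x) `|x i 0| <=
    norms1 s (H^T *m y) + s%:R * (gbar * norm1 x + nuH).
  apply: (@le_trans _ _ (\sum_(i in top_set s x)
      (`|(H^T *m y) i 0| + (gbar * norm1 x + nuH)))).
    apply: ler_sum => i _; have := residual_error 0 i.
    rewrite mulmx0 !subr0 => r; rewrite -lerBlDl (le_trans _ r) //.
    by rewrite distrC lerB_dist.
  rewrite big_split /= sumr_const card_top_set //.
  rewrite -[X in _ + X <= _]mulr_natl lerD2r.
  by apply: sum_le_norms1; rewrite ?card_top_set.
have := x_tail; rewrite norm1_tailE.
move: top_le; rewrite (norm1_setID (top_set s x)); lra.
Qed.

Lemma nemp_stepE k i : let w := (H^T *m (y - A *m v k)) i 0 in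
  v k.+1 i 0 =
  v k i 0 + Num.sg w * Num.max 0 (`|w| - (gbar * alpha k + nuH)).
Proof.
have [-> _] := nemp_recE k.
by rewrite /nemp_step mxE [X in _ + X]mxE opprD [in RHS]addrA.
Qed.

Lemma nemp_coord k i : norm1 (x - v k) <= alpha k ->
  Conv2 0 (x i 0) (v k i 0) ->
  Conv2 0 (x i 0) (v k.+1 i 0)
  /\ `|(x - v k.+1) i 0| <= 2 * gbar * alpha k + 2 * nuH.
Proof.
move=> hb /Conv2_0P ha.
have r := le_trans (residual_error (v k) i)
  (lerD (ler_wpM2l gbar_ge0 hb) (lexx nuH)).
move: (soft_threshold_between r) (soft_threshold_error r) => /=.
rewrite Conv2_0P [(x - v k.+1) i 0]mxE [(x - v k) i 0]mxE.
rewrite [(- v k.+1) i 0]mxE [(- v k) i 0]mxE nemp_stepE.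
set D := Num.sg _ * _ => e1 e2; split; first by lra.
by rewrite opprD addrA (le_trans e2) //; lra.
Qed.

(** The [s] entries of the top set of [x] contribute [s] times the uniform error;
    on the others the iterate lies between [0] and [x_i], so the error is at most
    [|x_i|]. *)
Lemma norm1_le_alphaS k :
  norm1 (x - v k) <= alpha k ->
  (forall i, Conv2 0 (x i 0) (v k i 0)) ->
  norm1 (x - v k.+1) <= alpha k.+1.
Proof.
move=> hb ha; have [_ ->] := nemp_recE k.
rewrite (norm1_setID (top_set s x)) lerD //.
  have -> : 2 * s%:R * gbar * alpha k + 2 * s%:R * nuH =
      \sum_(i in top_set s x) (2 * gbar * alpha k + 2 * nuH).
    by rewrite sumr_const card_top_set // -[RHS]mulr_natl; ring.
  by apply: ler_sum => i _; have [] := nemp_coord hb (ha i).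
apply: le_trans x_tail; rewrite norm1_tailE.
apply: ler_sum => i _; have [/Conv2_0P vx _] := nemp_coord hb (ha i).
rewrite !mxE; case: vx => /andP[v1 v2].
  by rewrite !ger0_norm ?subr_ge0; lra.
by rewrite !ler0_norm ?subr_le0; lra.
Qed.

Lemma nemp_correct k :
  (forall i, Conv2 0 (x i 0) (v k i 0)) /\
  (norm1 (x - v k) <= alpha k /\
   `|x - v k.+1| <= 2 * gbar * alpha k + 2 * nuH).
Proof.
have inv : (forall i, Conv2 0 (x i 0) (v k i 0)) /\ norm1 (x - v k) <= alpha k.
  elim: k => [|k [ha hb]].
    split; last by rewrite /v /= subr0; exact: norm1_le_alpha0.
    move=> i; rewrite /v /= mxE Conv2_0P lexx andbT /=.
    by case: (leP 0 (x i 0)) => [|/ltW]; [left | right].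
  by split; [move=> i; have [] := nemp_coord hb (ha i) | exact: norm1_le_alphaS].
have [ha hb] := inv; split=> //; split=> //.
rewrite -[`|_|]/(mx_norm _) mx_normrE; apply/bigmax_leP; split=> [|[i j] _ /=].
  rewrite addr_ge0 // !mulr_ge0 //; first by rewrite (le_trans (norm1_ge0 _) hb).
by rewrite (ord1 j); have [] := nemp_coord hb (ha i).
Qed.

End Pursuit.

(** * The standard normal law on the line *)

(** The measurability of [f] is an argument, because the measure structure of
    the pushforward depends on it and cannot be inferred from [f]. *)
Definition image_measure d1 d2 (T1 : measurableType d1) (T2 : measurableType d2)
    (R : realType) (m : {measure set T1 -> \bar R}) (f : T1 -> T2)
    (mf : measurable_fun setT f) : {measure set T2 -> \bar R} :=
  measure_function_pushforward__canonical__measure_function_Measure m mf.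

Lemma measurable_affine (R : realType) (a b : R) :
  measurable_fun setT (fun z : R => a + b * z).
Proof. by apply: measurable_funD => //; exact: measurable_funM. Qed.

(** Half-open intervals determine Lebesgue measure, and their preimages under an
    affine map are intervals. *)
Lemma lebesgue_measure_affine (R : realType) (a b : R) (E : set R) :
  b != 0 -> measurable E ->
  lebesgue_measure E =
    (`|b|%:E * lebesgue_measure [set z | E (a + b * z)%R])%E.
Proof.
move=> b0 mE.
have mf : measurable_fun setT
  ((fun z => a + b * z) : measurableTypeR R -> measurableTypeR R).
  exact: measurable_affine.
pose L := mscale (NngNum (normr_ge0 b)) (image_measure lebesgue_measure mf).
suff : lebesgue_measure E = L E by [].
apply: lebesgue_measure_unique => // _ [[x y] _ <-] /=.
rewrite /L /mscale /= /pushforward /=.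
have [bp|bn] := ltP 0 b.
  have -> : (fun z : R => a + b * z) @^-1` `]x, y]%classic =
      `](x - a) / b, (y - a) / b]%classic.
    apply/seteqP; split => z /=; rewrite !in_itv /= ltr_pdivrMr // ler_pdivlMr //
      ![z * b]mulrC ltrBlDl lerBrDl //.
  rewrite !lebesgue_measure_itv /= !lte_fin ltr_pM2r ?invr_gt0 // ltrD2r.
  case: ifP => _; last by rewrite mule0.
  rewrite -!EFinB -EFinM; congr EFin.
  by rewrite gtr0_norm //; field; rewrite gt_eqF.
(* A decreasing map turns the interval into one closed on the left. *)
have {}bn : b < 0 by rewrite lt_neqAle b0.
have -> : (fun z : R => a + b * z) @^-1` `]x, y]%classic =
      `[(y - a) / b, (x - a) / b[%classic.
  apply/seteqP; split => z /=; rewrite !in_itv /= ltr_ndivlMr // ler_ndivrMr //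
      ![z * b]mulrC ltrBlDl lerBrDl; by rewrite andbC.
rewrite !lebesgue_measure_itv /= !lte_fin ltr_nM2r ?invr_lt0 // ltrD2r.
case: ifP => _; last by rewrite mule0.
rewrite -!EFinB -EFinM; congr EFin.
by rewrite ltr0_norm //; field; rewrite lt_eqF.
Qed.

Lemma ge0_integral_affine (R : realType) (a b : R) (f : R -> \bar R) :
  b != 0 -> measurable_fun setT f -> (forall x, 0 <= f x)%E ->
  (\int[lebesgue_measure]_x f x =
    `|b|%:E * \int[lebesgue_measure]_z f (a + b * z)%R)%E.
Proof.
move=> b0 mf f0.
have mg : measurable_fun setT
  ((fun z => a + b * z) : measurableTypeR R -> measurableTypeR R).
  exact: measurable_affine.
pose L := mscale (NngNum (normr_ge0 b)) (image_measure lebesgue_measure mg).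
transitivity (\int[L]_x f x)%E.
  by apply: eq_measure_integral => E mE _; exact: lebesgue_measure_affine.
rewrite ge0_integral_mscale //=; congr (_ * _)%E.
by rewrite ge0_integral_pushforward.
Qed.

Lemma bounded_integrable d (T : measurableType d) (R : realType)
    (P : probability T R) (f : T -> \bar R) :
  measurable_fun setT f -> (forall x, 0 <= f x <= 1)%E ->
  P.-integrable setT f.
Proof.
move=> mf f01; apply/integrableP; split=> //.
apply: (@le_lt_trans _ _ (\int[P]_(x in [set: T]) cst 1 x)%E).
  apply: ge0_le_integral => //=; first exact: measurableT_comp.
  by move=> x _; have /andP[f0 f1] := f01 x; rewrite gee0_abs.
by rewrite integral_cst // mul1e; rewrite [X in (X < _)%E]probability_setT ltry.
Qed.

(** The density has the same integrals over measurable sets as the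
    Radon-Nikodym derivative of the law, hence is almost everywhere equal to
    it. *)
Lemma integral_normal_prob (R : realType) (f : R -> \bar R) :
  measurable_fun setT f -> (forall x, 0 <= f x <= 1)%E ->
  (\int[normal_prob 0 1]_x f x =
   \int[lebesgue_measure]_x (f x * (normal_pdf 0 1 x)%:E))%E.
Proof.
move=> mf f01; have dom := @normal_prob_dominates R 0 1.
rewrite -(Radon_Nikodym_change_of_variables dom) //; last first.
  exact: bounded_integrable.
apply: ae_eq_integral => //.
- exact: emeasurable_funM.
- apply: emeasurable_funM => //; apply/measurable_EFinP.
  exact: measurable_normal_pdf.
- apply: ae_eqe_mul2l; apply: integral_ae_eq => //.
  + exact: Radon_Nikodym_integrable.
  + by apply/measurable_EFinP; exact: measurable_normal_pdf.
  + by move=> E _ mE; rewrite -Radon_Nikodym_integral.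
Qed.

Lemma ge0_integral_affineV (R : realType) (c b : R) (f : R -> \bar R) :
  b != 0 -> measurable_fun setT f -> (forall x, 0 <= f x)%E ->
  (\int[lebesgue_measure]_x f ((x - c) / b)%R =
    `|b|%:E * \int[lebesgue_measure]_z f z)%E.
Proof.
move=> b0 mf f0; rewrite (@ge0_integral_affine _ c b) //; last first.
  apply: (measurableT_comp mf).
  by apply: measurable_funM => //; exact: measurable_funB.
congr (_ * _)%E; apply: eq_integral => z _.
by congr f; rewrite addrC addKr mulrC mulKf.
Qed.

Lemma std_normal_pdfE (R : realType) (z : R) :
  normal_pdf 0 1 z = normal_peak 1 * expR (- (z ^+ 2 / 2)).
Proof. by rewrite normal_pdfE ?oner_eq0 // /normal_fun subr0 expr1n mulNr. Qed.

(** With [y = (w - a x) / b], the point [(w, (x - a w) / b)] is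
    [(a x + b y, b x - a y)], the image of [(x, y)] under a reflection; the
    standard normal density of the plane depends only on the norm. *)
Lemma std_normal_pdf_rotate (R : realType) (a b x w : R) :
  b != 0 -> a ^+ 2 + b ^+ 2 = 1 ->
  normal_pdf 0 1 ((w - a * x) / b) * normal_pdf 0 1 x =
  normal_pdf 0 1 w * normal_pdf 0 1 ((x - a * w) / b) :> R.
Proof.
move=> b0 ab; rewrite !std_normal_pdfE [LHS]mulrACA [RHS]mulrACA -!expRD.
congr (_ * expR _); rewrite -!opprD -!mulrDl; congr (- (_ / _)).
have b20 : b ^+ 2 != 0 by rewrite expf_neq0.
rewrite !expr_div_n; apply: (mulIf b20); rewrite !mulrDl !divfK //.
have -> : b ^+ 2 = 1 - a ^+ 2 by rewrite -ab; ring.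
ring.
Qed.

Lemma normal_prob_preim (R : realType) (f : R -> R) (C : set R) :
  measurable_fun setT f -> measurable C ->
  (normal_prob 0 1 [set z | C (f z)] =
  \int[lebesgue_measure]_z ((\1_C (f z))%:E * (normal_pdf 0 1 z)%:E))%E.
Proof.
move=> mf mC; rewrite /normal_prob integral_mkcond.
apply: eq_integral => z _; rewrite patchE indicE.
have -> : (z \in [set z | C (f z)]) = (f z \in C) by apply/idP/idP; rewrite !inE.
by case: ifP => _; rewrite ?mul1e ?mul0e.
Qed.
Lemma xsection_lincomb (R : realType) (a b x : R) (C : set R) :
  xsection [set z : R * R | C (a * z.1 + b * z.2)] x =
  [set y | C (a * x + b * y)].
Proof. by apply/seteqP; split => y /=; rewrite /xsection /= inE. Qed.

Lemma measurable_lincomb (R : realType) (a b : R) :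
  measurable_fun setT (fun z : R * R => a * z.1 + b * z.2).
Proof.
apply: measurable_funD; apply: measurable_funM => //.
Qed.

(** Write the left-hand side as the integral over [x] and [y] of
    [phi x * phi y] on [a x + b y \in C]. Replacing [y] by [w = a x + b y] turns
    the density into [phi w * phi ((x - a w) / b) / |b|], by
    [std_normal_pdf_rotate], and for fixed [w] its integral over [x] is [phi w]. *)
Lemma normal_prob_rotate (R : realType) (a b : R) (C : set R) :
  b != 0 -> a ^+ 2 + b ^+ 2 = 1 -> measurable C ->
  (normal_prob 0 1 \x normal_prob 0 1)%E
    [set z : R * R | C (a * z.1 + b * z.2)] = normal_prob 0 1 C.
Proof.
move=> b0 ab mC.
have bn0 : `|b| != 0 by rewrite normr_eq0.
pose K (x w : R) : \bar R := (`|b|^-1 * \1_C w * (normal_pdf 0 1 w *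
  normal_pdf 0 1 ((x - a * w) / b)))%:E.
have mK : measurable_fun setT (fun z : R * R => K z.1 z.2).
  apply/measurable_EFinP; apply: measurable_funM.
    by apply: measurable_funM => //; apply: measurableT_comp.
  apply: measurable_funM; apply: measurableT_comp => //;
    try exact: measurable_normal_pdf.
  by apply: measurable_funM => //; apply: measurable_funB => //; exact: measurable_funM.
have K0 x w : (0 <= K x w)%E.
  by rewrite lee_fin !mulr_ge0 ?normal_pdf_ge0 ?invr_ge0 // indicE ler0n.
have mD : measurable [set z : R * R | C (a * z.1 + b * z.2)].
  by rewrite -[X in measurable X]setTI; exact: measurable_lincomb.
have inner x : (normal_prob 0 1 [set y | C (a * x + b * y)%R] *
    (normal_pdf 0 1 x)%:E = \int[lebesgue_measure]_w K x w)%E.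
  rewrite (normal_prob_preim (measurable_affine (a * x) b)) //.
  pose f y : \bar R := ((\1_C (a * x + b * y))%:E * (normal_pdf 0 1 y)%:E)%E.
  have mf : measurable_fun setT f.
    apply: emeasurable_funM; apply/measurable_EFinP.
      by apply: measurableT_comp => //; exact: measurable_affine.
    exact: measurable_normal_pdf.
  have f0 y : (0 <= f y)%E.
    by rewrite mule_ge0 ?lee_fin ?normal_pdf_ge0 // indicE ler0n.
  rewrite -/f.
  have -> : (\int[lebesgue_measure]_z f z =
      `|b|^-1%:E * \int[lebesgue_measure]_w f ((w - a * x) / b)%R)%E.
    by rewrite ge0_integral_affineV // muleA -EFinM mulVf // mul1e.
  have mfV : measurable_fun setT (fun w : R => f ((w - a * x) / b)).
    apply: (measurableT_comp mf).
    by apply: measurable_funM => //; exact: measurable_funB.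
  rewrite muleAC -EFinM.
  have k0 : 0 <= `|b|^-1 * normal_pdf 0 1 x.
    by rewrite mulr_ge0 ?invr_ge0 ?normal_pdf_ge0.
  rewrite -(ge0_integralZl_EFin lebesgue_measure measurableT
    (fun w _ => f0 _) mfV k0).
  apply: eq_integral => w _; rewrite /f /K mulrCA divff // mulr1 addrC subrK.
  rewrite -!EFinM; congr EFin.
  by rewrite -(std_normal_pdf_rotate _ _ b0 ab); ring.
transitivity (\int[normal_prob 0 1]_x
    normal_prob 0 1 [set y | C (a * x + b * y)%R])%E.
  by apply: eq_integral => x _ /=; rewrite xsection_lincomb.
have sectE : (fun x : R => normal_prob 0 1 [set y | C (a * x + b * y)]) =
    normal_prob 0 1 \o xsection [set z : R * R | C (a * z.1 + b * z.2)].
  by apply/funext => x /=; rewrite xsection_lincomb.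
rewrite integral_normal_prob; last 2 first.
- by rewrite sectE; exact: measurable_fun_xsection.
- move=> x; rewrite measure_ge0 probability_le1 //.
  by rewrite -[X in measurable X]setTI; exact: measurable_affine.
under eq_integral do rewrite inner.
transitivity (\int[lebesgue_measure]_w \int[lebesgue_measure]_x K x w)%E.
  refine (@fubini_tonelli _ _ _ _ R lebesgue_measure lebesgue_measure
    (fun z => K z.1 z.2) mK (fun z => K0 _ _)).
rewrite -[in RHS](preimage_id C) (normal_prob_preim (f := id)) //.
apply: eq_integral => w _.
have -> : (\int[lebesgue_measure]_x K x w =
  (`|b|^-1 * \1_C w * normal_pdf 0 1 w)%:E *
  \int[lebesgue_measure]_x (normal_pdf 0 1 ((x - a * w) / b))%:E)%E.
  have k0 : 0 <= `|b|^-1 * \1_C w * normal_pdf 0 1 w.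
    by rewrite !mulr_ge0 ?invr_ge0 ?normal_pdf_ge0 // indicE ler0n.
  rewrite -(ge0_integralZl_EFin lebesgue_measure measurableT _ _ k0).
  - by apply: eq_integral => x _; rewrite /K -EFinM !mulrA.
  - by move=> x _; rewrite lee_fin normal_pdf_ge0.
  - apply/measurable_EFinP; apply: measurableT_comp.
      exact: measurable_normal_pdf.
    by apply: measurable_funM => //; exact: measurable_funB.
rewrite (@ge0_integral_affineV _ _ _ (fun x => (normal_pdf 0 1 x)%:E)) //.
- rewrite integral_normal_pdf mule1 -!EFinM; congr EFin.
  by rewrite mulrC !mulrA divff // mul1r.
- by apply/measurable_EFinP; exact: measurable_normal_pdf.
- by move=> x; rewrite lee_fin normal_pdf_ge0.
Qed.

(** Dividing by [sqrt (r^2 + h^2)] makes the combination a rotation. When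
    [h = 0], the assumption [0 <= r] gives [sqrt (r^2) = r]. *)
Lemma normal_prob_lincomb (R : realType) (r h : R) (C : set R) :
  0 <= r -> measurable C ->
  (normal_prob 0 1 \x normal_prob 0 1)%E
    [set z : R * R | C (r * z.1 + h * z.2)] =
  normal_prob 0 1 [set z | C (Num.sqrt (r ^+ 2 + h ^+ 2) * z)].
Proof.
move=> r0 mC; have [->|h0] := eqVneq h 0.
  rewrite expr0n addr0 sqrtr_sqr ger0_norm //.
  have -> : [set z : R * R | C (r * z.1 + 0 * z.2)] =
      [set z | C (r * z)] `*` setT.
    by apply/seteqP; split => -[x y] /=; rewrite mul0r addr0 // => -[].
  rewrite product_measure1E //; first by rewrite [X in (_ * X)%E]probability_setT mule1.
  by rewrite -[X in measurable X]setTI; exact: mulrl_measurable.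
have rho0 : 0 < r ^+ 2 + h ^+ 2.
  by rewrite ltr_wpDl ?sqr_ge0 // exprn_even_gt0.
set rho := Num.sqrt _; have rhoN0 : rho != 0 by rewrite gt_eqF ?sqrtr_gt0.
rewrite -(@normal_prob_rotate _ (r / rho) (h / rho)).
- congr (_ \x _)%E; apply/funext => z /=; congr C; field.
  exact: rhoN0.
- by rewrite mulf_neq0 ?invr_neq0.
- rewrite !expr_div_n -mulrDl sqr_sqrtr ?(ltW rho0) // divff // gt_eqF //.
- by rewrite -[X in measurable X]setTI; exact: mulrl_measurable.
Qed.

(** [e] is a sign, so that one statement covers both half-lines. Translating by
    [e t] carries the half-line from [0] to the one from [t], and
    [(z + e t)^2 >= z^2 + t^2] for [z] in the former. *)
Lemma normal_prob_half_tail (R : realType) (e t : R) :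
  e ^+ 2 = 1 -> 0 <= t ->
  (normal_prob 0 1 [set z | (t < e * z)%R] <=
   (expR (- (t ^+ 2 / 2)))%:E * normal_prob 0 1 [set z | (0 < e * z)%R])%E.
Proof.
move=> e1 t0.
have mhalf u : measurable [set z : R | u < e * z].
  rewrite -[X in measurable X]setTI.
  by apply: measurable_fun_ltr => //; exact: mulrl_measurable.
have mI u : measurable_fun setT (fun z => (\1_[set z : R | u < e * z] z)%:E *
    (normal_pdf 0 1 z)%:E)%E.
  by apply: emeasurable_funM; apply/measurable_EFinP;
    [exact: measurable_indic | exact: measurable_normal_pdf].
have I0 u z : (0 <= (\1_[set z : R | u < e * z] z)%:E *
    (normal_pdf 0 1 z)%:E)%E.
  by rewrite mule_ge0 ?lee_fin ?normal_pdf_ge0 // indicE ler0n.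
rewrite !(normal_prob_preim (f := id) _ (mhalf _)) //.
rewrite (ge0_integral_affine (e * t) (oner_neq0 R) (mI t) (I0 t)) normr1 mul1e.
rewrite -(ge0_integralZl_EFin lebesgue_measure measurableT
  (fun z _ => I0 0 z) (mI 0) (expR_ge0 _)).
apply: ge0_le_integral => //.
- exact: (measurableT_comp (mI t) (measurable_affine (e * t) 1)).
- exact: measurable_funeM (mI 0).
move=> z _; rewrite -!EFinM lee_fin !indicE mul1r.
have -> : (e * t + z \in [set z : R | t < e * z]) =
    (z \in [set z : R | 0 < e * z]).
  apply/idP/idP; rewrite !inE /= mulrDr mulrA -expr2 e1 mul1r ?ltrDl //.
case: (boolP (z \in _)) => [|_]; last by rewrite !mul0r mulr0.
rewrite inE /= !mul1r => ez; rewrite !std_normal_pdfE mulrCA.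
rewrite ler_wpM2l ?normal_peak_ge0 // -expRD ler_expR sqrrD exprMn e1 mul1r.
have : 0 <= (e * z) * t by rewrite mulr_ge0 // ltW.
lra.
Qed.

(** Each half-tail is at most [exp (- t^2 / 2)] times the mass of its half-line,
    and the two half-lines have total mass at most [1]. *)
Lemma normal_prob_tail (R : realType) (t : R) :
  0 <= t ->
  (normal_prob 0 1 [set z | (t < `|z|)%R] <= (expR (- (t ^+ 2 / 2)))%:E)%E.
Proof.
move=> t0.
have mhalf e u : measurable [set z : R | u < e * z].
  rewrite -[X in measurable X]setTI.
  by apply: measurable_fun_ltr => //; exact: mulrl_measurable.
have split u : 0 <= u -> [set z : R | u < `|z|] =
    [set z | u < 1 * z] `|` [set z | u < -1 * z].
  move=> u0; apply/seteqP; split => z /=; rewrite mul1r mulN1r lter_normr.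
    by move/orP.
  by move=> ?; apply/orP.
have splitN u : 0 <= u -> normal_prob 0 1 [set z : R | u < `|z|] =
  (normal_prob 0 1 [set z : R | u < 1 * z]%R +
   normal_prob 0 1 [set z : R | u < -1 * z]%R)%E.
  move=> u0; rewrite split // measureU; [by []|exact: mhalf|exact: mhalf|].
  by apply/seteqP; split => // z /=; rewrite mul1r mulN1r => -[? ?]; lra.
rewrite splitN //.
apply: le_trans (leeD (normal_prob_half_tail _ t0) (normal_prob_half_tail _ t0)) _.
- by rewrite expr1n.
- by rewrite sqrrN expr1n.
rewrite -ge0_muleDr ?measure_ge0 // -splitN // -[leRHS]mule1.
apply: lee_wpmul2l; first by rewrite lee_fin expR_ge0.
apply: probability_le1; rewrite split //.
by apply: measurableU; exact: mhalf.
Qed.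

Lemma measure_eq_rect d1 d2 (T1 : measurableType d1) (T2 : measurableType d2)
    (R : realType) (m1 m2 : {measure set (T1 * T2) -> \bar R}) :
  (m1 setT < +oo)%E ->
  (forall A B, measurable A -> measurable B -> m1 (A `*` B) = m2 (A `*` B)) ->
  forall D, measurable D -> m1 D = m2 D.
Proof.
move=> fin1 eq12 D mD.
apply: (measure_unique [set A `*` B | A in measurable & B in measurable]
  (fun=> setT)) => //.
- exact: measurable_prod_measurableType.
- move=> _ _ [A1 mA1 [B1 mB1 <-]] [A2 mA2 [B2 mB2 <-]].
  exists (A1 `&` A2); first exact: measurableI.
  by exists (B1 `&` B2); [exact: measurableI | rewrite setXI].
- by move=> _; exists setT => //; exists setT => //; rewrite setXTT.
- by rewrite bigcup_const.
- by move=> _ [A mA [B mB <-]]; exact: eq12.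
Qed.

(** * Linear forms of a standard normal vector *)

Section GaussianSum.
Variables (R : realType) (m : nat) (d : measure_display) (T : measurableType d).
Variables (P : probability T R) (X : 'I_m -> T -> R) (h : 'I_m -> R).
Hypothesis mX : forall i, measurable_fun setT (X i).
Hypothesis X_law : forall i B, measurable B ->
  P [set t | B (X i t)] = normal_prob 0 1 B.
Hypothesis X_indep : forall B : 'I_m -> set R, (forall i, measurable (B i)) ->
  P [set t | forall i, B i (X i t)] = (\prod_(i < m) P [set t | B i (X i t)])%E.

Let S k t := \sum_(i < m | (i < k)%N) h i * X i t.
Let q k := \sum_(i < m | (i < k)%N) h i ^+ 2.

Lemma measurable_partial_sum k : measurable_fun setT (S k).
Proof.
rewrite (_ : S k =
    fun t => \sum_(i < m) (if (i < k)%N then h i else 0) * X i t).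
  by apply: measurable_sum => i; exact: measurable_funM.
apply/funext => t; rewrite /S big_mkcond; apply: eq_bigr => i _.
by case: ifP => // _; rewrite mul0r.
Qed.

Lemma measurable_cylinder (B : 'I_m -> set R) (Q : pred 'I_m) :
  (forall i, measurable (B i)) ->
  measurable [set t | forall i, Q i -> B i (X i t)].
Proof.
move=> mB.
have -> : [set t | forall i, Q i -> B i (X i t)] =
    \bigcap_(i in [set i | Q i]) (X i @^-1` B i) by [].
apply: fin_bigcap_measurable => // i _.
by rewrite -[X in measurable X]setTI; exact: mX.
Qed.

(** Induction on [k]. Carrying the events of the coordinates from [k] on along
    with the partial sum is what expresses, by probabilities of rectangles only,
    that [S k] is independent of the rest. In the step, the joint law of [S k]
    and [X k] on the event of the later coordinates agrees on rectangles, up to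
    the probability [p] of that event, with the law of [(r z1, z2)] for
    [r = sqrt (q k)] and independent standard normal [z1] and [z2]; it is then evaluated on
    [s + h_k x \in C]. Describing the law of [S k] as that of [sqrt (q k) * z]
    covers [q k = 0], where [normal_prob] is not a Dirac mass. *)
Lemma partial_sum_law (k : nat) (C : set R) (B : 'I_m -> set R) :
  (k <= m)%N -> measurable C -> (forall i, measurable (B i)) ->
  P ([set t | C (S k t)] `&`
     [set t | forall i : 'I_m, (k <= i)%N -> B i (X i t)]) =
  (normal_prob 0 1 [set z | C (Num.sqrt (q k) * z)%R] *
   \prod_(i < m | (k <= i)%N) normal_prob 0 1 (B i))%E.
Proof.
elim: k C B => [|k IH] C B km mC mB.
  have S0 t : S 0 t = 0 by rewrite /S big_pred0.
  have q0 : q 0 = 0 by rewrite /q big_pred0.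
  rewrite q0 sqrtr0.
  have [C0|C0] := pselect (C 0); last first.
    rewrite (_ : _ `&` _ = set0); last first.
      by apply/seteqP; split => // t [] /=; rewrite S0.
    rewrite (_ : [set z | C (0 * z)] = set0).
      by rewrite !measure0 mul0e.
    by apply/seteqP; split => // z /=; rewrite mul0r.
  rewrite (_ : _ `&` _ = [set t | forall i, B i (X i t)]); last first.
    apply/seteqP; split => [t [_ /= h0] i|t hB]; first exact: h0.
    by split => /= [|i _]; [rewrite S0 | exact: hB].
  rewrite (_ : [set z | C (0 * z)] = setT); last first.
    by apply/seteqP; split => // z _ /=; rewrite mul0r.
  rewrite [X in (X * _)%E]probability_setT mul1e X_indep //.
  by apply: eq_bigr => i _; exact: X_law.
pose i0 := Ordinal km.
pose E := [set t | forall i : 'I_m, (k < i)%N -> B i (X i t)].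
have mE : measurable E.
  exact: (@measurable_cylinder B (fun i : 'I_m => (k < i)%N)).
pose p := (\prod_(i < m | (k < i)%N) normal_prob 0 1 (B i))%E.
have p_fin : p \is a fin_num.
  by apply: prode_fin_num => i _; apply: fin_num_measure; exact: mB.
have p0 : 0 <= fine p.
  apply/fine_ge0; rewrite /p; elim/big_ind: _ => // x y; exact: mule_ge0.
have mpair : measurable_fun setT (fun t => (S k t, X i0 t)).
  by apply: measurable_fun_pair => //; exact: measurable_partial_sum.
have mscl : measurable_fun setT
    (fun z : R * R => (Num.sqrt (q k) * z.1, z.2)).
  apply: measurable_fun_pair => //.
  by apply: measurable_funM.
pose m1 := image_measure (mrestr P mE) mpair.
pose m2 := mscale (NngNum p0) (image_measure
  (normal_prob 0 1 \x normal_prob 0 1)%E mscl).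
have m12 D : measurable D -> m1 D = m2 D.
  apply: measure_eq_rect.
    rewrite /m1 /= /pushforward /mrestr preimage_setT setTI.
    by rewrite (le_lt_trans (probability_le1 P mE)) ?ltry.
  move=> A D' mA mD'.
  pose B' i := if i == i0 then D' else B i.
  have mB' i : measurable (B' i) by rewrite /B'; case: ifP.
  have := IH A B' (ltnW km) mA mB'.
  rewrite (bigD1 i0) //= {2}/B' eqxx.
  have -> : (\prod_(i < m | (k <= i)%N && (i != i0)) normal_prob 0 1 (B' i))%E
      = p.
    apply: eq_big => [i|i /andP[_ /negbTE ii0]]; last by rewrite /B' ii0.
    by rewrite ltn_neqAle andbC eq_sym.
  have -> : [set t | A (S k t)] `&`
      [set t | forall i : 'I_m, (k <= i)%N -> B' i (X i t)] =
      (fun t => (S k t, X i0 t)) @^-1` (A `*` D') `&` E.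
    apply/seteqP; split => t /=.
      move=> [At hB']; split; first split => //=.
        by have := hB' i0 (leqnn k); rewrite /B' eqxx.
      move=> i ki; have := hB' i (ltnW ki); rewrite /B'; case: eqP => // ii0.
      by rewrite ii0 ltnn in ki.
    move=> [[/= At Dt] hE]; split=> // i; rewrite leq_eqVlt => /orP[/eqP ki|ki].
      have -> : i = i0 by apply: val_inj; rewrite /= ki.
      by rewrite /B' eqxx.
    rewrite /B'; case: eqP => [-> //|_]; exact: hE.
  rewrite /m1 /m2 /mscale /= /pushforward /mrestr => ->.
  have -> : (fun z : R * R => (Num.sqrt (q k) * z.1, z.2)) @^-1` (A `*` D') =
      [set z | A (Num.sqrt (q k) * z)] `*` D' by [].
  rewrite product_measure1E //; last first.
    by rewrite -[X in measurable X]setTI; exact: mulrl_measurable.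
  by rewrite fineK // muleA muleC.
have mD : measurable [set z : R * R | C (z.1 + h i0 * z.2)].
  rewrite -[X in measurable X]setTI.
  have := measurable_lincomb 1 (h i0).
  under eq_fun do rewrite mul1r.
  exact.
have := m12 _ mD.
rewrite /m1 /m2 /mscale /= /pushforward /mrestr /=.
have -> : (fun z : R * R => (Num.sqrt (q k) * z.1, z.2)) @^-1`
    [set z | C (z.1 + h i0 * z.2)] =
  [set z : R * R | C (Num.sqrt (q k) * z.1 + h i0 * z.2)] by [].
have SS t : S k.+1 t = S k t + h i0 * X i0 t.
  rewrite /S (bigD1 i0) //= addrC; congr (_ + _); apply: eq_bigl => i.
  by rewrite ltnS [RHS]ltn_neqAle andbC -val_eqE.
have qS : q k.+1 = q k + h i0 ^+ 2.
  rewrite /q (bigD1 i0) //= addrC; congr (_ + _); apply: eq_bigl => i.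
  by rewrite ltnS [RHS]ltn_neqAle andbC -val_eqE.
have q_ge0 : 0 <= q k by apply: sumr_ge0 => i _; exact: sqr_ge0.
rewrite normal_prob_lincomb ?sqrtr_ge0 // sqr_sqrtr // -qS fineK // => eqP12.
rewrite muleC -[in RHS]/p -eqP12; congr (P (_ `&` _)).
by apply/funext => t /=; rewrite SS.
Qed.

Lemma gaussian_sum_law (C : set R) : measurable C ->
  P [set t | C (\sum_i h i * X i t)] =
  normal_prob 0 1 [set z | C (Num.sqrt (\sum_i h i ^+ 2) * z)].
Proof.
move=> mC; have := @partial_sum_law m C (fun=> setT) (leqnn m) mC
  (fun=> measurableT).
rewrite [X in (_ * X)%E]big_pred0 => [|i]; last by rewrite leqNgt ltn_ord.
rewrite mule1 (_ : [set t | forall i : 'I_m, _] = setT) ?setIT; last first.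
  by apply/seteqP; split.
have -> : q m = \sum_i h i ^+ 2 by apply: eq_bigl => i; rewrite ltn_ord.
move=> <-; congr (P _); apply/funext => t /=; congr C.
by apply: eq_bigl => i; rewrite ltn_ord.
Qed.

(** When [h = 0] the event is empty, because its inequality is strict. *)
Lemma gaussian_sum_tail (tau : R) : 0 <= tau ->
  (P [set t | (tau * Num.sqrt (\sum_i h i ^+ 2) < `|\sum_i h i * X i t|)%R]
   <= (expR (- (tau ^+ 2 / 2)))%:E)%E.
Proof.
move=> tau0; set r := Num.sqrt _.
have mtail u : measurable [set z : R | u < `|z|].
  rewrite -[X in measurable X]setTI.
  by apply: measurable_fun_ltr => //; exact: measurableT_comp.
rewrite (gaussian_sum_law (mtail _)) -/r.
apply: le_trans (normal_prob_tail tau0).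
apply: le_measure; rewrite ?inE; [|exact: mtail|].
  by rewrite -[X in measurable X]setTI; exact: (mulrl_measurable r _ (mtail _)).
move=> z /=; rewrite normrM (ger0_norm (sqrtr_ge0 _)) -/r mulrC => rz.
have r0 : 0 < r.
  rewrite lt_neqAle sqrtr_ge0 andbT eq_sym; apply: contraTneq rz => ->.
  by rewrite !mul0r ltxx.
by rewrite ltr_pM2l in rz.
Qed.

End GaussianSum.

(** * The noise event *)

Lemma continuous_linform (R : realType) (m : nat) (v : 'cV[R]_m) :
  continuous (fun u : 'cV[R]_m => (u^T *m v) 0 0).
Proof.
have -> : (fun u : 'cV[R]_m => (u^T *m v) 0 0) =
    (fun u => \sum_j u j 0 * v j 0).
  by apply/funext => u; rewrite mxE; apply: eq_bigr => j _; rewrite mxE.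
rewrite -fct_sumE.
apply: (@big_ind _ (fun f : 'cV[R]_m -> R =>
  continuous f)) => [u|f g cf cg u|j _ u].
- exact: (@cst_continuous _ _ (0 : R) u).
- exact: (cvgD (cf u) (cg u)).
- apply: (@cvgM _ _ (nbhs u) _ (fun w : 'cV[R]_m => w j 0) (fun=> v j 0)).
    exact: (@coord_continuous R m 1 j 0 u).
  exact: cvg_cst.
Qed.

(** The supremum is finite by compactness, and the symmetry of [U] makes it bound
    the absolute value. *)
Lemma linform_le_sup (R : realType) (m : nat) (U : set 'cV[R]_m)
    (u v : 'cV[R]_m) :
  compact U -> symmetric_set U -> U u ->
  `|(u^T *m v) 0 0| <= sup [set (u^T *m v) 0 0 | u in U].
Proof.
move=> Uc Us Uu; set E := [set _ | _ in _].
have ubE : has_ubound E.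
  have [] : has_sup E => //; apply: compact_has_sup.
    by exists ((u^T *m v) 0 0); exists u.
  apply: continuous_compact => //.
  exact/continuous_subspaceT/continuous_linform.
rewrite ler_norml lerNl; apply/andP; split; apply: ub_le_sup => //.
  by exists (- u); [exact: Us | rewrite linearN mulNmx mxE].
by exists u.
Qed.

Definition good_noise (R : realType) (m n : nat) (tau : R) (H : 'M[R]_(m, n)) :
    set 'cV[R]_m :=
  [set xi | forall i, `|(xi^T *m col i H) 0 0| <= tau * norm2 (col i H)].

(** The set is closed, as an intersection of preimages of closed half-lines. *)
Lemma good_noise_borel (R : realType) (m n : nat) (tau : R)
    (H : 'M[R]_(m, n)) :
  <<s [set O : set 'cV[R]_m | open O] >> (good_noise tau H).
Proof.
rewrite -[good_noise _ _]setCK; apply: sigma_algebraC; apply: sub_sigma_algebra.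
have cl : closed (\bigcap_(i in [set: 'I_n])
    [set xi : 'cV[R]_m | `|(xi^T *m col i H) 0 0| <= tau * norm2 (col i H)]).
  apply: closed_bigI => i _.
  apply: (@closed_comp _ _ (fun xi : 'cV[R]_m => `|(xi^T *m col i H) 0 0|)
    [set z | z <= _]); last exact: closed_le.
  move=> xi _; apply: continuous_comp; first exact: continuous_linform.
  exact: norm_continuous.
have -> : good_noise tau H = \bigcap_(i in [set: 'I_n])
    [set xi : 'cV[R]_m | `|(xi^T *m col i H) 0 0| <= tau * norm2 (col i H)].
  by apply/seteqP; split => xi /= hxi i; [move=> _; exact: hxi | exact: hxi].
exact: closed_openC.
Qed.

Lemma probability_all d (T : measurableType d) (R : realType)
    (P : probability T R) (n : nat) (B : 'I_n -> set T) (c : R) :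
  (forall i, measurable (B i)) -> (forall i, (P (B i) <= c%:E)%E) ->
  ((1 - c *+ n)%:E <= P [set t | forall i, ~ B i t])%E.
Proof.
move=> mB PB; pose bad := \big[setU/set0]_(i in [pred i : 'I_n | true]) B i.
have [mbad Pbad] : measurable bad /\
    (P bad <= \sum_(i in [pred i : 'I_n | true]) c%:E)%E.
  rewrite /bad; elim/big_ind2: _ => [|A x A' x' [mA Ax] [mA' Ax']|i _].
  - by rewrite measure0.
  - split; first exact: measurableU.
    by apply: le_trans (measureU2 _ mA mA') _; exact: leeD.
  - by split.
have -> : [set t | forall i, ~ B i t] = ~` bad.
  rewrite /bad -bigcup_pred; apply/seteqP; split => t /= hB.
    by move=> [i _ Bi]; exact: (hB _ Bi).
  by move=> i Bi; apply: hB; exists i.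
rewrite probability_setC // EFinB; apply: leeB => //.
by move: Pbad; rewrite sumEFin sumr_const card_ord.
Qed.

Lemma good_noise_prob (R : realType) (m n : nat) (eps : R) (H : 'M[R]_(m, n))
    (d : measure_display) (T : measurableType d) (P : probability T R)
    (xi : T -> 'cV[R]_m) :
  (0 < n)%N -> 0 < eps -> eps < 1 -> standard_normal_vector P xi ->
  ((1 - eps)%:E <=
   P [set t | good_noise (Num.sqrt (2 * ln (n%:R / eps))) H (xi t)])%E.
Proof.
move=> n0 eps0 eps1 [mxi xi_law xi_indep]; set tau := Num.sqrt _.
have n0R : 0 < n%:R :> R by rewrite ltr0n.
have ln0 : 0 <= ln (n%:R / eps).
  apply: ln_ge0; rewrite ler_pdivlMr // mul1r (le_trans (ltW eps1)) //.
  by rewrite ler1n.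
have tauE : expR (- (tau ^+ 2 / 2)) = eps / n%:R.
  rewrite /tau sqr_sqrtr ?mulr_ge0 // mulrC mulKf ?pnatr_eq0 //.
  by rewrite expRN lnK ?posrE ?divr_gt0 // invf_div.
pose h i j := H j i.
pose B i := [set t | tau * Num.sqrt (\sum_j h i j ^+ 2) <
  `|\sum_j h i j * xi t j 0|].
have mB i : measurable (B i).
  rewrite -[X in measurable X]setTI; apply: measurable_fun_ltr => //.
  apply: measurableT_comp => //; apply: measurable_sum => j.
  exact: measurable_funM.
have PB i : (P (B i) <= (eps / n%:R)%:E)%E.
  rewrite -tauE; apply: (@gaussian_sum_tail _ _ _ _ P (fun j t => xi t j 0)) => //.
  exact: sqrtr_ge0.
have := probability_all mB PB.
rewrite -[_ *+ n]mulr_natr divfK ?gt_eqF // => /le_trans; apply.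
rewrite le_eqVlt; apply/orP; left; apply/eqP; congr (P _).
apply/funext => t /=; rewrite propeqE /good_noise /=.
have E i : B i t <-> ~ (`|((xi t)^T *m col i H) 0 0| <= tau * norm2 (col i H)).
  rewrite /B /= /norm2.
  have -> : \sum_j h i j * xi t j 0 = ((xi t)^T *m col i H) 0 0.
    by rewrite mxE; apply: eq_bigr => j _; rewrite !mxE mulrC.
  have -> : \sum_j h i j ^+ 2 = \sum_(j < m) col i H j 0 ^+ 2.
    by apply: eq_bigr => j _; rewrite mxE.
  by rewrite ltNge; split=> /negP.
split=> hB i; first by apply: contrapT => hi; apply: (hB i); apply/E.
by move=> /E; apply; exact: hB.
Qed.

Lemma noise_bound (R : realType) (m n : nat) (U : set 'cV[R]_m)
    (sigma eps : R) (H : 'M[R]_(m, n)) (u xi : 'cV[R]_m) (i : 'I_n) :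
  0 <= sigma -> compact U -> symmetric_set U -> U u ->
  good_noise (Num.sqrt (2 * ln (n%:R / eps))) H xi ->
  `|(H^T *m (u + sigma *: xi)) i 0| <= nu_mx U sigma eps H.
Proof.
move=> sigma0 Uc Us Uu /(_ i) good.
apply: (@le_trans _ _ (nu n U sigma eps (col i H))); last first.
  exact: (@le_bigmax _ _ _ 0 (fun i => nu n U sigma eps (col i H)) i).
have -> : (H^T *m (u + sigma *: xi)) i 0 =
    (u^T *m col i H) 0 0 + sigma * (xi^T *m col i H) 0 0.
  rewrite !mxE mulr_sumr -big_split; apply: eq_bigr => j _.
  by rewrite !mxE /=; ring.
apply: le_trans (ler_normD _ _) _; apply: lerD; first exact: linform_le_sup.
by rewrite normrM ger0_norm // -mulrA ler_wpM2l.
Qed.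

Theorem proposition9 (R : realType) (m n : nat) (A : 'M[R]_(m, n))
    (sigma eps : R) (U : set 'cV[R]_m) (s : nat) (gbar upsilon : R)
    (H : 'M[R]_(m, n))
    (sigma_gt0 : 0 < sigma) (eps_gt0 : 0 < eps) (eps_lt1 : eps < 1)
    (U_nonempty : U !=set0) (U_convex : convex_set U) (U_compact : compact U)
    (U_sym : symmetric_set U)
    (s_gt0 : (0 < s)%N) (s_le_n : (s <= n)%N)
    (gbar_ge0 : 0 <= gbar) (upsilon_ge0 : 0 <= upsilon)
    (H_gbar : forall i j : 'I_n, `|(1%:M - H^T *m A) i j| <= gbar)
    (H_nu : nu_mx U sigma eps H = omega_star U sigma eps A gbar)
    (s_gbar : s%:R * gbar < 1) :
  exists Xi : set 'cV[R]_m,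
    [/\ (* Xi is a Borel set *)
        <<s [set O : set 'cV[R]_m | open O] >> Xi,
        (forall (d : measure_display) (T : measurableType d)
                (P : probability T R) (xi : T -> 'cV[R]_m),
          standard_normal_vector P xi ->
          ((1 - eps)%:E <= P [set t | Xi (xi t)])%E)
      & forall xi : 'cV[R]_m, Xi xi ->
        forall x : 'cV[R]_n, norm1 (x - keep_largest s x) <= upsilon ->
        forall u : 'cV[R]_m, U u ->
        let y := A *m x + u + sigma *: xi in
        let v k := (nemp A H gbar (nu_mx U sigma eps H) s upsilon y k).1 in
        let alpha k := (nemp A H gbar (nu_mx U sigma eps H) s upsilon y k).2 in
        forall k : nat,
          (forall i : 'I_n, Conv2 0 (x i 0) (v k i 0))
          /\ (norm1 (x - v k) <= alpha k
              /\ `|x - v k.+1|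
                   <= 2 * gbar * alpha k + 2 * omega_star U sigma eps A gbar)].
Proof.
exists (good_noise (Num.sqrt (2 * ln (n%:R / eps))) H); split.
- exact: good_noise_borel.
- by move=> d T P xi; apply: good_noise_prob => //; exact: leq_trans s_le_n.
move=> xi good x x_tail u Uu y v alpha k; rewrite -H_nu.
apply: nemp_correct => //.
- exact: bigmax_ge_id.
- move=> i; have -> : y - A *m x = u + sigma *: xi.
    by rewrite /y addrC !addrA addNr add0r.
  by apply: noise_bound => //; exact: ltW.
Qed.
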